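(* Let $(x^*,s^* )$ be a KKT pair of (P) ($\nabla f(x^* )-\nabla c(x^* )s^*=0$, $c(x^* )\ge0$, $s^*\ge0$, $(s^* )^Tc(x^* )=0$). Assume: $f$ and $c_i$ are twice differentiable on $\mathbb{R}^n$ with second derivatives Lipschitz continuous in a neighborhood of $x^*$; the gradients $\nabla c_i(x^* )$, $i\in\{i:c_i(x^* )=0\}$, are linearly independent; strict complementarity $s^*+c(x^* )>0$ holds; and for a fixed $\rho_0>0$ the matrix $$B^*=\nabla^2f(x^* )-\sum_{i=1}^m s_i^*\nabla^2c_i(x^* )+\rho_0\sum_{i:\,s_i^*>0}\nabla c_i(x^* )\nabla c_i(x^* )^T$$ is positive definite. Then there exist positive scalars $\bar\mu,\varepsilon,\delta$ such that for all $(s,\mu)\in D=\{(s,\mu):\|s-s^*\|\le\delta,\ \mu\in[0,\bar\mu)\}$ the problem $\min\{F(x,s;\mu,\rho_0):\|x-x^*\|<\varepsilon\}$ has a unique solution $x(s;\mu)$; the map $(s,\mu)\mapsto x(s;\mu)$ is continuously differentiable in the interior of $D$; and there is a constant $C>0$ such that for all $(s,\mu)\in D$, $$\|x(s;\mu)-x^*\|\le C(\|s-s^*\|+\mu),\qquad \|\tilde s(s;\mu)-s^*\|\le C(\|s-s^*\|+\mu),$$ where $\tilde s(s;\mu)=\rho_0\,y(x(s;\mu),s;\mu,\rho_0)$.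
   Context: Problem (P): $\min f(x)$ s.t. $c(x)\ge0$, with $f:\mathbb{R}^n\to\mathbb{R}$, $c=(c_1,\dots,c_m):\mathbb{R}^n\to\mathbb{R}^m$; $\nabla c(x)\in\mathbb{R}^{n\times m}$ has $i$-th column $\nabla c_i(x)$. For $\mu\ge0$, $\rho>0$, $x\in\mathbb{R}^n$, $s\in\mathbb{R}^m$ define $z_i(x,s;\mu,\rho)=\frac{1}{2\rho}\big(\sqrt{(s_i-\rho c_i(x))^2+4\rho\mu}-(s_i-\rho c_i(x))\big)$, $y_i(x,s;\mu,\rho)=\frac{1}{2\rho}\big(\sqrt{(s_i-\rho c_i(x))^2+4\rho\mu}+(s_i-\rho c_i(x))\big)$, $h_i(x,s;\mu,\rho)=-\mu\ln z_i(x,s;\mu,\rho)+\frac{\rho}{2}y_i(x,s;\mu,\rho)^2-\frac{1}{2\rho}s_i^2$ (for $\mu=0$ the term $-\mu\ln z_i$ is omitted), and $F(x,s;\mu,\rho)=f(x)+\sum_{i=1}^m h_i(x,s;\mu,\rho)$; $y=(y_i)$. $\|\cdot\|$ is the Euclidean norm. *)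

(* Defs.v *)
From HB Require Import structures.
From mathcomp Require Import all_boot all_order all_algebra.
From mathcomp Require Import all_classical all_reals all_analysis.
Set Implicit Arguments. Unset Strict Implicit. Unset Printing Implicit Defensive.
Import Order.TTheory GRing.Theory Num.Theory.
Import numFieldNormedType.Exports.
Local Open Scope ring_scope.

Section Defs.
Variable R : realType.

Definition enorm (k : nat) (v : 'rV[R]_k) : R := Num.sqrt (\sum_(j < k) v 0 j ^+ 2).

Definition frob (k l : nat) (A : 'M[R]_(k, l)) : R :=
  Num.sqrt (\sum_(i < k) \sum_(j < l) A i j ^+ 2).

Definition ebasis (k : nat) (j : 'I_k) : 'rV[R]_k := delta_mx 0 j.

Definition grad (k : nat) (g : 'rV[R]_k -> R) (x : 'rV[R]_k) : 'rV[R]_k :=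
  \row_j ('D_(ebasis j) g x).

Definition hess (k : nat) (g : 'rV[R]_k -> R) (x : 'rV[R]_k) : 'M[R]_k :=
  \matrix_(i, j) ('D_(ebasis j) (fun y => grad g y 0 i) x).

Definition twice_diff (k : nat) (g : 'rV[R]_k -> R) : Prop :=
  forall x, differentiable g x /\ differentiable (grad g) x.

Definition hess_lipschitz_near (k : nat) (g : 'rV[R]_k -> R) (x0 : 'rV[R]_k) : Prop :=
  exists r L : R, 0 < r /\ forall x y, enorm (x - x0) < r -> enorm (y - x0) < r ->
    frob (hess g x - hess g y) <= L * enorm (x - y).

Definition lin_indep_family (k m : nat) (P : pred 'I_m) (v : 'I_m -> 'rV[R]_k) : Prop :=
  forall a : 'I_m -> R, \sum_(i < m | P i) a i *: v i = 0 -> forall i, P i -> a i = 0.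

Definition posdef (k : nat) (B : 'M[R]_k) : Prop :=
  forall v : 'rV[R]_k, v != 0 -> 0 < (v *m B *m v^T) 0 0.

Variables (n m : nat) (f : 'rV[R]_n -> R) (c : 'I_m -> 'rV[R]_n -> R).

Definition zfun (x : 'rV[R]_n) (s : 'rV[R]_m) (mu rho : R) (i : 'I_m) : R :=
  (Num.sqrt ((s 0 i - rho * c i x) ^+ 2 + 4 * rho * mu) - (s 0 i - rho * c i x)) / (2 * rho).

Definition yfun (x : 'rV[R]_n) (s : 'rV[R]_m) (mu rho : R) (i : 'I_m) : R :=
  (Num.sqrt ((s 0 i - rho * c i x) ^+ 2 + 4 * rho * mu) + (s 0 i - rho * c i x)) / (2 * rho).

Definition hfun (x : 'rV[R]_n) (s : 'rV[R]_m) (mu rho : R) (i : 'I_m) : R :=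
  (if mu == 0 then 0 else - mu * ln (zfun x s mu rho i))
  + rho / 2 * yfun x s mu rho i ^+ 2 - (s 0 i) ^+ 2 / (2 * rho).

Definition Ffun (x : 'rV[R]_n) (s : 'rV[R]_m) (mu rho : R) : R :=
  f x + \sum_(i < m) hfun x s mu rho i.

Definition yvec (x : 'rV[R]_n) (s : 'rV[R]_m) (mu rho : R) : 'rV[R]_m :=
  \row_i yfun x s mu rho i.

End Defs.

(* Main.v *)
Require Import Defs.
From HB Require Import structures.
From mathcomp Require Import all_boot all_order all_algebra.
From mathcomp Require Import all_classical all_reals all_analysis.
From mathcomp Require Import ring lra.
Set Implicit Arguments. Unset Strict Implicit. Unset Printing Implicit Defensive.
Import Order.TTheory GRing.Theory Num.Theory.
Import numFieldNormedType.Exports.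
Local Open Scope ring_scope.
Local Open Scope classical_set_scope.

(** Put [w_i = s_i - rho c_i(x)] and
    [sigma_i = rho y_i = (sqrt(w_i^2 + 4 rho mu) + w_i) / 2]. Differentiating gives
    [grad_x F = G := grad f - sum_i sigma_i grad c_i]. Strict complementarity keeps
    [w_i] away from 0 near [(xstar, sstar)], so [G] is C^1 in [(x, s, mu)] near
    [(xstar, sstar, 0)], where its [x]-derivative is the matrix of the second-order
    condition. Hence near that point [G] is uniformly strongly monotone in [x], and
    [F] is strongly convex on a ball around [xstar]. As [G(xstar, s, mu)] is small,
    the minimizer of [F] over a smaller closed ball is interior, hence a zero
    [X(s, mu)] of [G], and strong convexity makes it the unique minimizer. Strong
    monotonicity bounds [X(s, mu) - xstar] by
    [G(xstar, s, mu) = O(|s - sstar| + mu)]. It also inverts the linearization of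
    [G(X(p), p) = 0], which gives the derivative of [X] and its continuity. *)

(** * First-order expansions and the dot product *)

Section FrechetEpsilon.
Context {R : realType} {V W : normedModType R}.

Lemma differentiable_le (f : V -> W) (x : V) : differentiable f x ->
  forall e, 0 < e ->
  \forall y \near x, `|f y - f x - 'd f x (y - x)| <= e * `|y - x|.
Proof.
move=> /diff_locally/eqaddoP df e e0; have := df e e0.
rewrite !near_simpl /= => H.
rewrite (near_shift 0) /=.
near=> h; rewrite /= subr0 -[h + x - x]addrA subrr addr0.
have : `|(f \o shift x - (cst (f x) + 'd f x)) h| <= e * `|h| by near: h.
by rewrite -[(_ - _) h]/(_ h - _) /= -[(cst _ + _) h]/(f x + _) opprD addrA.
Unshelve. all: by end_near. Qed.

(** Uniqueness of the differential lets a candidate [L], found by other means, be recognized as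
    ['d f x]. This is how the derivative of the implicit function is identified. *)
Lemma le_differentiable (f : V -> W) (x : V) (L : {linear V -> W}) :
  continuous L ->
  (forall e, 0 < e ->
     \forall y \near x, `|f y - f x - L (y - x)| <= e * `|y - x|) ->
  differentiable f x /\ 'd f x = L :> (V -> W).
Proof.
move=> cL fL.
have eqo : f \o shift x = cst (f x) + L +o_ 0 id.
  apply/eqaddoP => e e0; have := fL e e0; rewrite (near_shift 0 x) /= => H.
  near=> h.
  rewrite -[(_ - _) h]/(_ h - _) /= -[(cst _ + _) h]/(f x + _) opprD addrA.
  have : `|f (h + (x - 0)) - f x - L (h + (x - 0) - x)|
         <= e * `|h + (x - 0) - x| by near: h.
  by rewrite !subr0 -[h + x - x]addrA subrr addr0.
have dE := diff_unique cL eqo; split=> //.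
by apply/diff_locallyP; rewrite dE.
Unshelve. all: by end_near. Qed.

(** The differential contributes its operator bound [k] and the first-order remainder, taken with
    [e = 1], contributes the extra 1. The point [x] stays fixed; only [y] varies. *)
Lemma differentiable_lipschitz (f : V -> W) (x : V) : differentiable f x ->
  exists2 K, 0 < K & \forall y \near x, `|f y - f x| <= K * `|y - x|.
Proof.
move=> df; have [k k0 kP] := linear_lipschitz (diff_continuous df).
exists (k + 1); first by rewrite addr_gt0.
near=> y; rewrite -[f y - f x](subrK ('d f x (y - x))).
rewrite (le_trans (ler_normD _ _))// addrC mulrDl lerD//.
by near: y; exact: differentiable_le.
Unshelve. all: by end_near. Qed.

End FrechetEpsilon.

Section Dot.
Context {R : realType} {n : nat}.
Implicit Types x y z : 'rV[R]_n.

Definition dot x y : R := \sum_(j < n) x 0 j * y 0 j.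

Lemma dotDl x y z : dot (x + y) z = dot x z + dot y z.
Proof. by rewrite /dot -big_split; apply: eq_bigr => j _; rewrite mxE mulrDl. Qed.

Lemma dotZl a x y : dot (a *: x) y = a * dot x y.
Proof. by rewrite /dot mulr_sumr; apply: eq_bigr => j _; rewrite mxE mulrA. Qed.

Lemma dotC x y : dot x y = dot y x.
Proof. by apply: eq_bigr => j _; rewrite mulrC. Qed.

Lemma dotNl x y : dot (- x) y = - dot x y.
Proof. by rewrite -scaleN1r dotZl mulN1r. Qed.

Lemma dotBl x y z : dot (x - y) z = dot x z - dot y z.
Proof. by rewrite dotDl dotNl. Qed.

Lemma dotZr a x y : dot x (a *: y) = a * dot x y.
Proof. by rewrite dotC dotZl dotC. Qed.

Lemma dot_suml m (P : pred 'I_m) (g : 'I_m -> 'rV[R]_n) y :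
  dot (\sum_(i < m | P i) g i) y = \sum_(i < m | P i) dot (g i) y.
Proof.
apply: (big_morph (dot^~ y)) => [u v|]; first exact: dotDl.
by rewrite /dot big1// => j _; rewrite mxE mul0r.
Qed.

Lemma coord_le_norm x j : `|x 0 j| <= `|x|.
Proof.
rewrite [leRHS]/Num.Def.normr/= mx_normrE.
exact: (le_bigmax _ (fun i : 'I_1 * 'I_n => `|x i.1 i.2|) (0, j)).
Qed.

Lemma norm_rV_le x e : 0 <= e -> (forall j, `|x 0 j| <= e) -> `|x| <= e.
Proof.
move=> e0 xe; rewrite [leLHS]/Num.Def.normr/= mx_normrE.
by apply: bigmax_le => //= -[i j] _; rewrite /= ord1.
Qed.

(** Here [|x|] is the sup norm of the row vector, so Cauchy-Schwarz carries the factor [n]. This is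
    the source of the dimension factors below. *)
Lemma dot_le_norm x y : `|dot x y| <= n%:R * `|x| * `|y|.
Proof.
rewrite (le_trans (ler_norm_sum _ _ _))//.
rewrite (@le_trans _ _ (\sum_(j < n) `|x| * `|y|))//.
  apply: ler_sum => j _; rewrite normrM ler_pM ?coord_le_norm//.
by rewrite sumr_const card_ord -mulrA mulr_natl.
Qed.

Lemma norm_sq_le_dot x : `|x| ^+ 2 <= dot x x.
Proof.
have d0 : 0 <= dot x x by apply: sumr_ge0 => j _; rewrite -expr2 sqr_ge0.
rewrite -(sqr_sqrtr d0) ler_sqr ?nnegrE ?sqrtr_ge0//.
apply: norm_rV_le => [|j]; first exact: sqrtr_ge0.
rewrite -sqrtr_sqr ler_wsqrtr// /dot (bigD1 j)//= -expr2 lerDl.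
by apply: sumr_ge0 => i _; rewrite -expr2 sqr_ge0.
Qed.

Lemma enormE x : enorm x = Num.sqrt (dot x x).
Proof. by []. Qed.

Lemma norm_le_enorm x : `|x| <= enorm x.
Proof.
rewrite -[leLHS]ger0_norm// -sqrtr_sqr enormE ler_wsqrtr//.
exact: norm_sq_le_dot.
Qed.

(** The crude factor [n.+1] dominates the square root of [n] and stays positive for [n = 0], so it
    can be divided by. *)
Lemma enorm_le_norm x : enorm x <= n.+1%:R * `|x|.
Proof.
rewrite -[leRHS]ger0_norm ?mulr_ge0// -sqrtr_sqr enormE ler_wsqrtr//.
rewrite (le_trans (ler_norm _))// (le_trans (dot_le_norm _ _))//.
rewrite exprMn -mulrA -expr2 ler_wpM2r ?sqr_ge0// -natrX ler_nat.
by rewrite (leq_trans (leqnSn n))// -{1}[n.+1]expn1 leq_pexp2l.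
Qed.

Lemma dot_coord x j : x 0 j = dot x (ebasis R j).
Proof.
rewrite /dot (bigD1 j)//= /ebasis mxE !eqxx mulr1 big1 ?addr0// => i ij.
by rewrite mxE (negPf ij) andbF mulr0.
Qed.

Lemma dot_eq0 x : (forall y, dot x y = 0) -> x = 0.
Proof. by move=> x0; apply/rowP => j; rewrite dot_coord x0 mxE. Qed.

End Dot.

(** * Strong convexity from a coercive Hessian *)

Lemma is_derive_line (R : realType) (V W : normedModType R) (f : V -> W)
    (x d : V) (t : R) : differentiable f (t *: d + x) ->
  is_derive t (1 : R) (fun s : R => f (s *: d + x)) ('D_d f (t *: d + x)).
Proof.
move=> df; have dl : is_diff t (fun s : R => s *: d + x) (fun s => s *: d).
  rewrite (_ : (fun s : R => s *: d + x) = ( *:%R^~ d) + cst x)//.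
  apply: is_diff_eq.
  by apply/funext => s /=; rewrite -[LHS]/(s *: d + 0) addr0.
have dfl : differentiable (f \o (fun s : R => s *: d + x)) t.
  exact: differentiable_comp.
apply: DeriveDef; first exact: diff_derivable.
by rewrite deriveE// diff_comp// diff_val /= scale1r deriveE.
Qed.

Lemma is_derive_dotl (R : realType) (V : normedModType R) n
    (g : V -> 'rV[R]_n) (x v : V) (dg e : 'rV[R]_n) :
  is_derive x v g dg -> is_derive x v (fun y => dot (g y) e) (dot dg e).
Proof.
move=> [dxg <-]; have dgj j : derivable (fun y => g y 0 j) x v.
  by have /derivable_mxP := dxg; exact.
rewrite (_ : (fun y => _) = \sum_(j < n) (e 0 j *: (fun y => g y 0 j))); last first.
  by apply/funext => y; rewrite fct_sumE; apply: eq_bigr => j _; rewrite mulrC.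
apply: is_derive_eq.
  by apply: is_derive_sum => j; apply: is_deriveZ; exact: derivableP.
by rewrite derive_mx//; apply: eq_bigr => j _; rewrite mxE mulrC.
Qed.

(** Cauchy-Schwarz followed by cancelling one factor [|d|]: this turns each coercivity or
    monotonicity inequality below into a norm bound. *)
Lemma coercive_le (R : realType) n (a : R) (d g : 'rV[R]_n) :
  a * `|d| ^+ 2 <= dot g d -> a * `|d| <= n%:R * `|g|.
Proof.
have [->|d0] := eqVneq d 0; first by rewrite normr0 mulr0 mulr_ge0.
move=> /le_trans/(_ (le_trans (ler_norm _) (dot_le_norm _ _))).
by rewrite expr2 mulrA ler_pM2r// normr_gt0.
Qed.

Section StrongConvexity.
Context {R : realType} {n : nat}.
Variables (F : 'rV[R]_n -> R) (g : 'rV[R]_n -> 'rV[R]_n).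
Variables (x0 : 'rV[R]_n) (r a : R).
Hypothesis a_gt0 : 0 < a.
Hypothesis dF : forall x : 'rV[R]_n, `|x - x0| < r -> differentiable F x.
Hypothesis gF : forall x d : 'rV[R]_n, `|x - x0| < r -> 'D_d F x = dot (g x) d.
Hypothesis dg : forall x : 'rV[R]_n, `|x - x0| < r -> differentiable g x.
Hypothesis ag : forall x d : 'rV[R]_n, `|x - x0| < r ->
  a * `|d| ^+ 2 <= dot ('D_d g x) d.

Lemma ball_segment (x y : 'rV[R]_n) (t : R) :
  `|x - x0| < r -> `|y - x0| < r -> 0 <= t <= 1 ->
  `|t *: (y - x) + x - x0| < r.
Proof.
move=> xr yr /andP[t0 t1].
have -> : t *: (y - x) + x - x0 = t *: (y - x0) + (1 - t) *: (x - x0).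
  by apply/rowP => j; rewrite !mxE; ring.
rewrite (le_lt_trans (ler_normD _ _))// !normrZ (ger0_norm t0).
rewrite ger0_norm ?subr_ge0//.
(* Strictness comes from the term in [y], whose weight vanishes at [t = 0]; that case is the
   hypothesis on [x]. *)
have [->|tn0] := eqVneq t 0; first by rewrite mul0r add0r subr0 mul1r.
have : t * `|y - x0| < t * r by rewrite ltr_pM2l// lt_def tn0.
have : (1 - t) * `|x - x0| <= (1 - t) * r by rewrite ler_wpM2l ?subr_ge0// ltW.
lra.
Qed.

(** Mean value theorem for the component of [g] along [d], followed on the segment from [x] to [y]:
    its derivative is the quadratic form bounded below by [ag]. *)
Lemma grad_strong_mono (x y : 'rV[R]_n) : `|x - x0| < r -> `|y - x0| < r ->
  a * `|y - x| ^+ 2 <= dot (g y - g x) (y - x).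
Proof.
move=> xr yr; set d := y - x.
pose phi (t : R) := dot (g (t *: d + x)) d.
pose dphi (t : R) := dot ('D_d g (t *: d + x)) d.
have phiP (t : R) : 0 <= t <= 1 -> is_derive t (1:R) phi (dphi t).
  move=> t01; apply: is_derive_dotl; apply: is_derive_line.
  by apply: dg; exact: ball_segment.
have [|t||c c01] := @MVT R phi dphi 0 1.
- exact: ltr01.
- by rewrite in_itv /= => /andP[t0 t1]; apply: phiP; rewrite !ltW.
- apply: derivable_within_continuous => t; rewrite in_itv /= => t01.
  by have [] := phiP _ t01.
rewrite subr0 mulr1 /phi scale1r scale0r add0r /d subrK -/d -dotBl => ->.
move: c01; rewrite in_itv /= => /andP[c0 c1].
by apply: ag; apply: ball_segment => //; rewrite !ltW.
Qed.

(** [psi] is [F] on the segment minus its quadratic minorant. Strong monotonicity of [g] makes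
    [psi'] nonnegative, so [psi 0 <= psi 1] by the mean value theorem. *)
Lemma strong_convexity (x y : 'rV[R]_n) : `|x - x0| < r -> `|y - x0| < r ->
  F x + dot (g x) (y - x) + a / 2 * `|y - x| ^+ 2 <= F y.
Proof.
move=> xr yr; set d := y - x.
pose psi (t : R) := F (t *: d + x) - (t * dot (g x) d + a / 2 * `|d| ^+ 2 * t ^+ 2).
pose dpsi (t : R) := dot (g (t *: d + x)) d - (dot (g x) d + a * `|d| ^+ 2 * t).
have psiP (t : R) : 0 <= t <= 1 -> is_derive t (1:R) psi (dpsi t).
  move=> t01; have xt := ball_segment xr yr t01.
  apply: is_deriveB.
    by rewrite -gF//; apply: is_derive_line; exact: dF.
  rewrite (_ : (fun _ => _) = (dot (g x) d *: id) + (a / 2 * `|d| ^+ 2) *: (id ^+ 2)).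
    by apply: is_derive_eq; rewrite /GRing.scale /= !expr1; field.
  by apply/funext => s /=; rewrite mulrC.
have [|t||c c01] := @MVT R psi dpsi 0 1.
- exact: ltr01.
- by rewrite in_itv /= => /andP[t0 t1]; apply: psiP; rewrite !ltW.
- apply: derivable_within_continuous => t; rewrite in_itv /= => t01.
  by have [] := psiP _ t01.
rewrite subr0 mulr1 /psi scale1r scale0r add0r /d subrK -/d => psiE.
suff : 0 <= dpsi c by move: psiE; rewrite expr0n expr1n /=; lra.
move: c01; rewrite in_itv /= => /andP[c0 c1].
have xc : `|c *: d + x - x0| < r by apply: ball_segment => //; rewrite !ltW.
(* Monotonicity between [x] and [c *: d + x] has increment [c *: d]; dividing by [c > 0] gives the
   sign of [dpsi c]. *)
have := grad_strong_mono xr xc; rewrite addrK normrZ dotZr (ger0_norm (ltW c0)).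
rewrite exprMn (_ : _ * _ = c * (a * `|d| ^+ 2 * c)); last by ring.
by rewrite ler_pM2l// dotBl /dpsi; lra.
Qed.

(** [F] attains its minimum on the closed ball of radius [r']. Strong convexity from [x0] gives
    [a / 2 * |x - x0| <= n * |g x0|] at a minimizer [x], so [x] is interior, and Fermat's rule along
    every line yields [g x = 0]. *)
Lemma interior_critical_point (r' : R) : 0 < r' < r ->
  n%:R * `|g x0| < a / 2 * r' -> exists2 x : 'rV[R]_n, `|x - x0| < r' & g x = 0.
Proof.
move=> /andP[r'0 r'r] gx0.
have x0r : `|x0 - x0| < r by rewrite subrr normr0 (lt_trans r'0).
pose B := [set x : 'rV[R]_n | `|x - x0| <= r'].
have cB : compact B.
  apply: bounded_closed_compact.
    exists (`|x0| + r'); split; first exact: num_real.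
    move=> M rM x /= xB; rewrite (le_trans _ (ltW rM))//.
    by rewrite -[x](subrK x0) (le_trans (ler_normD _ _))// addrC lerD2l.
  rewrite (_ : B = closed_ball_ (fun x => `|x|) x0 r').
    exact: closed_closed_ball_.
  by apply/funext => x; rewrite /B /closed_ball_ /= distrC.
have [||x xB xmin] := EVT_min_rV _ cB (f := F).
- by exists x0; rewrite /B /= subrr normr0 ltW.
- apply: continuous_in_subspaceT => x; rewrite inE => xB.
  by apply: differentiable_continuous; apply: dF; exact: le_lt_trans xB r'r.
move: xB; rewrite inE /B /= => xB.
have xr : `|x - x0| < r' .
  have Fx : F x <= F x0 by apply: xmin; rewrite inE /B /= subrr normr0 ltW.
  have := strong_convexity x0r (le_lt_trans xB r'r) => H.
  have /coercive_le : a / 2 * `|x - x0| ^+ 2 <= dot (- g x0) (x - x0).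
    by rewrite dotNl; lra.
  rewrite normrN => /le_lt_trans/(_ gx0).
  by rewrite ltr_pM2l// divr_gt0.
exists x => //; apply: dot_eq0 => d.
have xrr := lt_trans xr r'r; rewrite -gF//.
have [->|d0] := eqVneq d 0; first by rewrite derive0.
have nd : 0 < `|d| by rewrite normr_gt0.
(* For [|t| < b] the point [t *: d + x] stays in the ball over which [x] minimizes [F]. *)
pose b := (r' - `|x - x0|) / `|d|.
have b0 : 0 < b by rewrite divr_gt0// subr_gt0.
have lineB (t : R) : t \in `]-b, b[%R -> `|t *: d + x - x0| < r'.
  rewrite in_itv /= -ltr_norml ltr_pdivlMr// => tb.
  by rewrite -addrA (le_lt_trans (ler_normD _ _))// normrZ; lra.
have lineD (t : R) : t \in `]-b, b[%R ->
    is_derive t (1 : R) (fun s : R => F (s *: d + x)) ('D_d F (t *: d + x)).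
  by move=> tb; apply: is_derive_line; apply: dF; exact: lt_trans (lineB _ tb) _.
have b00 : 0 \in `]-b, b[%R by rewrite in_itv /= oppr_lt0 b0.
have := @derive1_at_min R (fun s : R => F (s *: d + x)) (-b) b 0.
case.
- by rewrite (@le_trans _ _ 0)// ?oppr_le0 ltW.
- by move=> t /lineD[].
- exact: b00.
- move=> t tb; rewrite scale0r add0r; apply: xmin.
  by rewrite inE /B /= ltW// lineB.
by move=> _ <-; have [_ ->] := lineD _ b00; rewrite scale0r add0r.
Qed.

End StrongConvexity.

(** * Implicit differentiation of a coercive equation *)

(** Continuity of the derivative is required direction by direction, the form in which smoothness of
    the solution map is finally claimed. *)
Definition C1near (R : realType) (V W : normedModType R) (g : V -> W) (z0 : V) :=
  \forall z \near z0, differentiable g z /\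
    forall v, {for z, continuous (fun y => 'D_v g y)}.

Lemma cvg_sum (K : numFieldType) (V : normedModType K) (T : Type)
    (F : set_system T) {FF : Filter F} (I : Type) (r : seq I) (Q : pred I)
    (f : I -> T -> V) (l : I -> V) :
  (forall i, Q i -> f i x @[x --> F] --> l i) ->
  (\sum_(i <- r | Q i) f i x) @[x --> F] --> \sum_(i <- r | Q i) l i.
Proof.
move=> fl; rewrite (_ : (fun x => _) = \sum_(i <- r | Q i) f i); last first.
  by apply/funext => x; rewrite fct_sumE.
apply: (big_ind2 (fun (g : T -> V) (k : V) => g x @[x --> F] --> k)) => //.
  exact: cvg_cst.
by move=> g1 k1 g2 k2; exact: cvgD.
Qed.

Section ImplicitFunction.
Context {R : realType} {n : nat} {P : normedModType R}.
Implicit Types (d : 'rV[R]_n) (z : ('rV[R]_n * P)%type).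
Variable G : 'rV[R]_n * P -> 'rV[R]_n.

(** Reduces all directions [d] to finitely many partial derivatives, so that estimates become
    uniform in [d]. *)
Lemma derive_fst_sum z d : differentiable G z ->
  'D_(d, 0) G z = \sum_(j < n) d 0 j *: 'D_(ebasis R j, 0) G z.
Proof.
move=> dG; rewrite deriveE//.
have -> : (d, 0) = \sum_(j < n) d 0 j *: (ebasis R j, 0) :> 'rV[R]_n * P.
  apply: injective_projections => /=.
    by rewrite (raddf_sum fst) /= [LHS]row_sum_delta.
  by rewrite (raddf_sum snd) /= big1// => j _; rewrite scaler0.
by rewrite linear_sum; apply: eq_bigr => j _; rewrite linearZ /= deriveE.
Qed.

(** The quadratic form at [z0] has a positive minimum [a] on the compact unit sphere, hence
    dominates [a * |d| ^+ 2] by homogeneity. Continuity of the [n] partial derivatives costs at most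
    half of this constant near [z0]. *)
Lemma coercive_near z0 : C1near G z0 ->
  (forall d, d != 0 -> 0 < dot ('D_(d, 0) G z0) d) ->
  exists2 a, 0 < a & \forall z \near z0, forall d,
    a * `|d| ^+ 2 <= dot ('D_(d, 0) G z) d.
Proof.
move=> C1 pos; have [dG0 cG0] := nbhs_singleton C1.
pose q d := dot ('D_(d, 0) G z0) d.
have qZ (t : R) d : q (t *: d) = t ^+ 2 * q d.
  rewrite /q dotZr expr2 -mulrA; congr (_ * _); rewrite -dotZl; congr (dot _ _).
  rewrite !derive_fst_sum// scaler_sumr.
  by apply: eq_bigr => j _; rewrite mxE scalerA.
have [a a0 aP] : exists2 a, 0 < a & forall d, a * `|d| ^+ 2 <= q d.
  pose S := [set d : 'rV[R]_n | `|d| = 1].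
  (* The sphere is empty when [n = 0]; then every [d] is zero and any constant serves. *)
  have [[u Su]|S0] := pselect (S !=set0); last first.
    exists 1 => // d; rewrite (_ : d = 0).
      by rewrite normr0 expr0n mulr0 /q /dot big1// => j _; rewrite mxE mulr0.
    apply/eqP; apply: contrapT => /negP d0; apply: S0.
    by exists (`|d|^-1 *: d); rewrite /S /= normrZ normfV normr_id mulVf ?normr_eq0.
  have cS : compact S.
    apply: bounded_closed_compact.
      exists 1; split; first exact: num_real.
      by move=> M rM x /= ->; rewrite ltW.
    rewrite (_ : S = (fun d => `|d|) @^-1` [set 1])//.
    apply: closed_comp; last exact: closed_eq.
    by move=> x _; exact: norm_continuous.
  have [||m mS mmin] := EVT_min_rV _ cS (f := q).
  - by exists u.
  - apply: continuous_subspaceT => x.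
    rewrite (_ : q = fun d => \sum_(i < n) \sum_(j < n)
        (d 0 j * d 0 i * ('D_(ebasis R j, 0) G z0) 0 i)); last first.
      apply/funext => d; rewrite /q derive_fst_sum// /dot; apply: eq_bigr => i _.
      rewrite summxE mulr_suml; apply: eq_bigr => j _; rewrite mxE; ring.
    apply: (@cvg_sum _ _ _ (nbhs x)) => i _.
    apply: (@cvg_sum _ _ _ (nbhs x)) => j _.
    apply: (@cvgM _ _ (nbhs x)); last exact: cvg_cst.
    by apply: (@cvgM _ _ (nbhs x)); exact: coord_continuous.
  move: mS; rewrite inE /S /= => m1.
  have m0 : m != 0 by rewrite -normr_eq0 m1 oner_eq0.
  exists (q m); first exact: pos.
  move=> d; have [->|d0] := eqVneq d 0.
    by rewrite normr0 expr0n mulr0 /q /dot big1// => j _; rewrite mxE mulr0.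
  have nd : `|d| != 0 by rewrite normr_eq0.
  have : q m <= q (`|d|^-1 *: d).
    by apply: mmin; rewrite inE /S /= normrZ normfV normr_id mulVf.
  by rewrite qZ exprVn ler_pdivlMl ?exprn_gt0 ?normr_gt0// mulrC.
exists (a / 2); first by rewrite divr_gt0.
(* Moving each partial derivative by [eta] changes the form by at most [n * n * eta * |d| ^+ 2],
   which is at most [a / 2 * |d| ^+ 2]. The [+ 1] keeps the denominator positive for [n = 0]. *)
pose eta := a / (2 * (n%:R * n%:R + 1)).
have nn1 : 0 < n%:R * n%:R + 1 :> R by rewrite ltr_pwDr// mulr_ge0.
have eta0 : 0 < eta by rewrite divr_gt0// mulr_gt0.
have near_e j : \forall z \near z0,
    `|'D_(ebasis R j, 0) G z - 'D_(ebasis R j, 0) G z0| <= eta.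
  have /cvgrPdist_le/(_ eta eta0) := cG0 (ebasis R j, 0).
  by apply: filterS => z; rewrite distrC.
near=> z => d.
have dGz : differentiable G z by have [] : differentiable G z /\
    forall v, {for z, continuous (fun y => 'D_v G y)} by near: z.
have bnd : `|'D_(d, 0) G z - 'D_(d, 0) G z0| <= n%:R * eta * `|d|.
  rewrite !derive_fst_sum// -sumrB (le_trans (ler_norm_sum _ _ _))//.
  rewrite (@le_trans _ _ (\sum_(j < n) eta * `|d|))//.
    apply: ler_sum => j _; rewrite -scalerBr normrZ mulrC ler_pM//.
      by move: j; near: z; exact: filter_forall.
    exact: coord_le_norm.
  by rewrite sumr_const card_ord -mulrA mulr_natl.
have : q d - dot ('D_(d, 0) G z) d <= a / 2 * `|d| ^+ 2.
  rewrite -dotBl (le_trans (ler_norm _))// (le_trans (dot_le_norm _ _))//.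
  rewrite distrC (@le_trans _ _ (n%:R * (n%:R * eta * `|d|) * `|d|))//.
    by rewrite ler_wpM2r// ler_wpM2l.
  rewrite (_ : _ * _ = (n%:R * n%:R * eta) * `|d| ^+ 2); last by ring.
  rewrite ler_wpM2r ?sqr_ge0// /eta.
  rewrite mulrA ler_pdivrMr ?mulr_gt0// (_ : _ / _ * _ = a * (n%:R * n%:R + 1)).
    by rewrite mulrC ler_wpM2l ?(ltW a0)// lerDl.
  by field.
have := aP d; lra.
Unshelve. all: by end_near. Qed.

Lemma linear_le_continuous (W : normedModType R) (L : {linear P -> W}) (k : R) :
  (forall v, `|L v| <= k * `|v|) -> continuous L.
Proof.
move=> Lk; apply/bounded_linear_continuous/linear_boundedP.
exists k; split; first exact: num_real.
by move=> r kr v; rewrite (le_trans (Lk v))// ler_wpM2r// ltW.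
Qed.

(** Coercivity makes the partial differential in the first variable injective, hence invertible in
    finite dimension. [L] is minus its inverse composed with the partial differential in the
    parameter. *)
Lemma implicit_linear z (a : R) : 0 < a -> differentiable G z ->
  (forall d, a * `|d| ^+ 2 <= dot ('D_(d, 0) G z) d) ->
  exists L : {linear P -> 'rV[R]_n}, continuous L /\
    forall v, 'd G z (L v, v) = 0.
Proof.
move=> a0 dG aG.
pose T d := 'd G z (d, 0).
have TL : linear T.
  move=> t x y; rewrite /T -linearP; congr ('d G z _).
  by apply: injective_projections => //=; rewrite scaler0 addr0.
pose Tm := GRing.isLinear.Build _ _ _ _ T TL.
pose TT : {linear 'rV[R]_n -> 'rV[R]_n} := HB.pack T Tm.
pose M := lin1_mx TT.
have TE d : d *m M = 'd G z (d, 0) by rewrite mul_rV_lin1.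
have Mu : M \in unitmx.
  rewrite -row_free_unit; apply: inj_row_free => d; rewrite TE => Td.
  have := aG d; rewrite deriveE// Td => /coercive_le.
  by rewrite normr0 mulr0 pmulr_rle0// normr_le0 => /eqP.
pose L0 (v : P) := - ('d G z (0, v)) *m invmx M.
have L0L : linear L0.
  move=> t x y; rewrite /L0 scalemxAl -mulmxDl; congr (_ *m _).
  rewrite scalerN -opprD -linearP; congr (- 'd G z _).
  by apply: injective_projections => //=; rewrite scaler0 addr0.
pose Lm := GRing.isLinear.Build _ _ _ _ L0 L0L.
pose L : {linear P -> 'rV[R]_n} := HB.pack L0 Lm.
have LE v : 'd G z (L v, 0) = - 'd G z (0, v).
  by rewrite -TE [L v]/(L0 v) /L0 mulmxKV.
exists L; split; last first.
  move=> v; rewrite (_ : (L v, v) = (L v, 0) + (0, v)).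
    by rewrite linearD LE addNr.
  by apply: injective_projections => /=; rewrite ?addr0 ?add0r.
(* [P] is an arbitrary normed space, so continuity of [L] needs a bound; coercivity applied to [L v]
   provides it. *)
have [k k0 kP] := linear_lipschitz (diff_continuous dG).
apply: (@linear_le_continuous _ _ (n%:R * k / a)) => v.
rewrite mulrAC ler_pdivlMr// mulrC.
have := aG (L v); rewrite deriveE// LE => /coercive_le/le_trans; apply.
rewrite normrN -mulrA ler_wpM2l// (le_trans (kP _))// ler_wpM2l ?(ltW k0)//.
by rewrite prod_normE /= normr0 max_r.
Qed.

Variables (X : P -> 'rV[R]_n) (U : set P) (a : R).
Hypothesis a0 : 0 < a.
Hypothesis XG : forall p, U p -> G (X p, p) = 0.
Hypothesis aG : forall p, U p -> forall d,
  a * `|d| ^+ 2 <= dot ('D_(d, 0) G (X p, p)) d.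
Hypothesis dG : forall p, U p -> differentiable G (X p, p).
Hypothesis cG : forall p, U p -> forall v,
  {for (X p, p), continuous (fun y => 'D_v G y)}.
Hypothesis lipX : forall p, U p ->
  exists2 K, 0 < K & \forall q \near p, U q -> `|X q - X p| <= K * `|q - p|.

(** Since [G] vanishes at [(X p, p)] and [(X q, q)], its differential on the increment between them
    is only a remainder, which [lipX] makes small relative to [|q - p|]. Coercivity transfers this
    to [X q - X p - L (q - p)]. *)
Lemma implicit_differentiable p : (\forall q \near p, U q) ->
  differentiable X p /\ forall v, 'D_('D_v X p, v) G (X p, p) = 0.
Proof.
move=> nU; have Up := nbhs_singleton nU.
have [L [cL LE]] := implicit_linear a0 (dG Up) (aG Up).
have [K K0 KP] := lipX Up.
have cX : X q @[q --> p] --> X p.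
  apply/cvgrPdist_le => e e0; near=> q; rewrite distrC.
  have Uq : U q by near: q.
  apply: (@le_trans _ _ (K * `|q - p|)).
    by move: Uq; near: q.
  rewrite mulrC -ler_pdivlMr//; near: q.
  have eK0 : 0 < e / K by rewrite divr_gt0.
  apply: filterS (nbhsx_ballx p _ eK0) => q.
  by rewrite -ball_normE /= distrC => /ltW.
have [] := @le_differentiable _ _ _ X p L cL.
  (* Chosen so that the final bound [n.+1 * e' * (K + 1)] equals [a * e]. *)
  move=> e e0; pose e' := e * a / (n.+1%:R * (K + 1)).
  have e'0 : 0 < e' by rewrite divr_gt0// mulr_gt0// addr_gt0.
  have nG : \forall q \near p,
      `|G (X q, q) - G (X p, p) - 'd G (X p, p) ((X q, q) - (X p, p))|
      <= e' * `|(X q, q) - (X p, p)|.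
    have cXp : (X q, q) @[q --> p] --> (X p, p).
      exact: (@cvg_pair _ _ _ _ (nbhs (X p)) (nbhs p) _ _ _ _ _ cX cvg_id).
    exact: (cXp _ (differentiable_le (dG Up) e'0)).
  near=> q.
  have Uq : U q by near: q.
  have Xqp : `|X q - X p| <= K * `|q - p| by move: Uq; near: q.
  have hle : `|(X q, q) - (X p, p)| <= (K + 1) * `|q - p|.
    rewrite prod_normE /= ge_max; apply/andP; split.
      by rewrite (le_trans Xqp)// ler_wpM2r// lerDl.
    by rewrite ler_peMl// lerDr ltW.
  have : `|G (X q, q) - G (X p, p) - 'd G (X p, p) ((X q, q) - (X p, p))|
      <= e' * `|(X q, q) - (X p, p)| by near: q.
  rewrite !XG// subrr sub0r normrN => dGh.
  set u := X q - X p - L (q - p).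
  (* Subtracting [(L (q - p), q - p)], which lies in the kernel of the differential, removes the
     parameter component. *)
  have dGu : 'd G (X p, p) (u, 0) = 'd G (X p, p) ((X q, q) - (X p, p)).
    rewrite -[RHS]subr0 -(LE (q - p)) -linearB; congr ('d G _ _).
    by apply: injective_projections => //=; rewrite subrr.
  have := aG Up u; rewrite deriveE ?dGu; last exact: dG.
  move=> /coercive_le H.
  rewrite -(ler_pM2l a0) (le_trans H)//.
  rewrite (@le_trans _ _ (n.+1%:R * (e' * ((K + 1) * `|q - p|))))//.
    rewrite ler_pM// ?ler_nat// (le_trans dGh)// ler_wpM2l//.
    exact: ltW.
  rewrite le_eqVlt; apply/orP; left; apply/eqP; rewrite /e'; field.
  by rewrite !gt_eqF// addr_gt0.
move=> dX dXL; split=> // v.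
by rewrite !deriveE// ?dXL ?LE//; exact: dG.
Unshelve. all: by end_near. Qed.

Lemma implicit_C1 p : (\forall q \near p, U q) ->
  differentiable X p /\ forall v, {for p, continuous (fun q => 'D_v X q)}.
Proof.
move=> nU; have Up := nbhs_singleton nU.
have [dX dXE] := implicit_differentiable nU; split=> // v.
(* Coercivity at [(X q, q)] bounds ['D_v X q - 'D_v X p] by ['D_(w, v) G (X q, q)]
   with the fixed direction [w := 'D_v X p], so only the continuity of directional
   derivatives of [G] is needed. *)
apply/cvgrPdist_le => e e0 /=.
have cX : X q @[q --> p] --> X p by exact: differentiable_continuous.
pose w : 'rV[R]_n := 'D_v X p.
pose e' := e * a / n.+1%:R.
have e'0 : 0 < e' by rewrite divr_gt0// mulr_gt0.
have nG : \forall q \near p, `|'D_(w, v) G (X q, q)| <= e'.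
  have cXp : (X q, q) @[q --> p] --> (X p, p).
      exact: (@cvg_pair _ _ _ _ (nbhs (X p)) (nbhs p) _ _ _ _ _ cX cvg_id).
  have /cvgrPdist_le/(_ e' e'0) H := @cG p Up (w, v).
  apply: (@filterS _ (nbhs p) _ _ _ _ (cXp _ H)) => q /=.
  by rewrite dXE sub0r normrN.
near=> q.
(* The linearized equation is also needed at [q], so [q] itself must be interior to [U]. *)
have nUq : \forall q' \near q, U q' by near: q; exact: near_join.
have Uq := nbhs_singleton nUq.
have [dXq dXqE] := implicit_differentiable nUq.
have := aG Uq (w - 'D_v X q).
rewrite (_ : 'D_(_, 0) G _ = 'D_(w, v) G (X q, q)); last first.
  have dGq := dG Uq.
  rewrite -[RHS]subr0 -(dXqE v) !deriveE// -linearB; congr ('d G _ _).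
  by apply: injective_projections => //=; rewrite subrr.
move=> /coercive_le H; rewrite -(ler_pM2l a0) (le_trans H)//.
rewrite (@le_trans _ _ (n.+1%:R * e'))//.
  rewrite ler_pM ?ler_nat//; near: q; exact: nG.
by rewrite /e' mulrC divfK// mulrC.
Unshelve. all: by end_near. Qed.

End ImplicitFunction.

(** * Minimizers depending on a parameter *)

Section ParametricMinimizer.
Context {R : realType} {n : nat} {P : normedModType R}.

Lemma derive_fst_slice (W : normedModType R) (G : 'rV[R]_n * P -> W) x (p : P) d :
  'D_d (fun y => G (y, p)) x = 'D_(d, 0) G (x, p).
Proof.
rewrite /derive.
suff -> : (fun h : R => h^-1 *: (((fun y => G (y, p)) \o shift x) (h *: d) - G (x, p)))
  = (fun h : R => h^-1 *: ((G \o shift (x, p)) (h *: (d, 0)) - G (x, p))) by [].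
apply/funext => h /=; congr (_ *: (G _ - _)).
by apply: injective_projections => //=; rewrite scaler0 add0r.
Qed.

Lemma differentiable_slice (W : normedModType R) (G : 'rV[R]_n * P -> W) x (p : P) :
  differentiable G (x, p) -> differentiable (fun y => G (y, p)) x.
Proof.
move=> dG; apply: (@differentiable_comp _ _ _ _ (fun y => (y, p)) G) => //.
Qed.

Variables (G : 'rV[R]_n * P -> 'rV[R]_n) (F : 'rV[R]_n -> P -> R) (A : set P).
Variables (x0 : 'rV[R]_n) (p0 : P).

(* The factor [n.+2] leaves room to pass from the sup norm of ['rV[R]_n] to the
   Euclidean norm. *)
Lemma parametric_minimizer :
  G (x0, p0) = 0 -> C1near G (x0, p0) ->
  (forall d, d != 0 -> 0 < dot ('D_(d, 0) G (x0, p0)) d) ->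
  (\forall z \near (x0, p0), A z.2 -> differentiable (F^~ z.2) z.1 /\
     forall d, 'D_d (F^~ z.2) z.1 = dot (G z) d) ->
  exists r dl C (X : P -> 'rV[R]_n), [/\ 0 < r, 0 < dl, 0 < C,
    (forall p, `|p - p0| < dl -> A p ->
      [/\ `|X p - x0| < r / n.+2%:R, `|X p - x0| <= C * `|p - p0| &
          forall x, `|x - x0| < r -> x != X p -> F (X p) p < F x p]) &
    (forall p, `|p - p0| < dl -> (\forall q \near p, A q) ->
      differentiable X p /\ forall v, {for p, continuous (fun q => 'D_v X q)})].
Proof.
move=> G0 C1 pos HF.
have [a a0 aG] := coercive_near C1 pos.
have [K K0 KP] := differentiable_lipschitz (nbhs_singleton C1).1.
have [r r0 rP] : exists2 r, 0 < r & forall x p, `|x - x0| < r -> `|p - p0| < r ->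
    [/\ differentiable G (x, p),
        forall v, {for (x, p), continuous (fun y => 'D_v G y)},
        forall d, a * `|d| ^+ 2 <= dot ('D_(d, 0) G (x, p)) d,
        `|G (x, p)| <= K * `|(x, p) - (x0, p0)| &
        A p -> differentiable (F^~ p) x /\
          forall d, 'D_d (F^~ p) x = dot (G (x, p)) d].
  have [r /= r0 rP] := (nbhs_normP (x0, p0) _).1
    (filterI C1 (filterI aG (filterI KP HF))).
  exists r => // x p xr pr; have := rP (x, p); case.
    rewrite /ball_ /= prod_normE /= gt_max distrC xr.
    by rewrite distrC pr.
  move=> /= [dG cG] [aGz [Kz HFz]]; split=> //.
  by move: Kz; rewrite G0 subr0.
pose r' := r / n.+2%:R.
have r'0 : 0 < r' by rewrite divr_gt0.
have r'r : r' < r by rewrite ltr_pdivrMr// ltr_pMr// ltr1n.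
(* As [|G (x0, p)| <= K * |p - p0|], the second term is what [interior_critical_point] asks for at
   radius [r']; [n.+1] replaces [n] to keep the divisor positive. *)
pose dl := Num.min r (a / 2 * r' / (n.+1%:R * K)).
have dl0 : 0 < dl by rewrite lt_min r0 divr_gt0// mulr_gt0// divr_gt0.
(* [A] need not be a neighborhood of [p0]: existence and estimates hold on all of [U],
   differentiability at points with a neighborhood inside [A]. *)
pose U := [set p | `|p - p0| < dl /\ A p].
have UP p : U p -> `|p - p0| < r by case; rewrite lt_min => /andP[].
have x0r : `|x0 - x0| < r by rewrite subrr normr0.
have dF p (Up : U p) x : `|x - x0| < r -> differentiable (F^~ p) x.
  by move=> xr; have [_ _ _ _ []] := rP _ _ xr (UP _ Up); first by case: Up.
have gF p (Up : U p) x d : `|x - x0| < r -> 'D_d (F^~ p) x = dot (G (x, p)) d.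
  by move=> xr; have [_ _ _ _ []] := rP _ _ xr (UP _ Up); first by case: Up.
have dg p (Up : U p) x : `|x - x0| < r -> differentiable (fun y => G (y, p)) x.
  move=> xr; apply: differentiable_slice.
  by have [] := rP _ _ xr (UP _ Up).
have ag p (Up : U p) x d : `|x - x0| < r ->
    a * `|d| ^+ 2 <= dot ('D_d (fun y => G (y, p)) x) d.
  move=> xr; rewrite derive_fst_slice.
  by have [_ _ aGz _ _] := rP _ _ xr (UP _ Up); exact: aGz.
have Gx0 p : U p -> `|G (x0, p)| <= K * `|p - p0|.
  move=> Up; have [_ _ _ + _] := rP _ _ x0r (UP _ Up).
  by rewrite prod_normE /= subrr normr0 max_r.
(* Outside [U], when no such zero exists, the value defaults to [x0]. *)
pose X p := xget x0 [set x | `|x - x0| < r' /\ G (x, p) = 0].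
have XP p : U p -> `|X p - x0| < r' /\ G (X p, p) = 0.
  move=> Up.
  have [||x xr' Gx] := interior_critical_point a0 (dF _ Up) (gF _ Up)
    (dg _ Up) (ag _ Up) (r' := r').
  - by rewrite r'0.
  - rewrite (@le_lt_trans _ _ (n.+1%:R * (K * `|p - p0|)))//.
      by rewrite ler_pM// ?ler_nat// Gx0.
    case: (Up); rewrite lt_min => /andP[_ + _].
    by rewrite ltr_pdivlMr ?mulr_gt0// mulrC mulrA.
  by apply: (@xgetPex _ x0 [set x | `|x - x0| < r' /\ G (x, p) = 0]); exists x.
have Xr p : U p -> `|X p - x0| < r by move=> /XP[h _]; exact: lt_trans h r'r.
(* Comparison with [x = x0] gives the error bound, and comparison with a solution for another
   parameter gives the Lipschitz bound. *)
have mono p x : U p -> `|x - x0| < r -> a * `|X p - x| <= n%:R * `|G (x, p)|.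
  move=> Up xr.
  have := grad_strong_mono (dg _ Up) (ag _ Up) xr (Xr _ Up).
  by rewrite (XP _ Up).2 sub0r => /coercive_le; rewrite normrN.
exists r, dl, (n.+1%:R * K / a), X; split=> //.
- by rewrite divr_gt0// mulr_gt0.
- move=> p pdl Ap; have Up : U p by [].
  split; first by case: (XP _ Up).
    rewrite mulrAC ler_pdivlMr// mulrC (le_trans (mono _ _ Up x0r))//.
    by rewrite -mulrA ler_pM// ?ler_nat// Gx0.
  move=> x xr xX.
  have := strong_convexity (dF _ Up) (gF _ Up) (dg _ Up) (ag _ Up) (Xr _ Up) xr.
  rewrite (XP _ Up).2 /dot big1 => [|j _]; last by rewrite mxE mul0r.
  rewrite addr0; apply: lt_le_trans; rewrite ltrDl mulr_gt0 ?divr_gt0//.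
  by rewrite exprn_gt0// normr_gt0 subr_eq0.
- move=> p pdl nA.
  apply: (@implicit_C1 R n P G X U a) => //.
  + by move=> q /XP[].
  + by move=> q Uq; have [] := rP _ _ (Xr _ Uq) (UP _ Uq).
  + by move=> q Uq; have [] := rP _ _ (Xr _ Uq) (UP _ Uq).
  + by move=> q Uq; have [] := rP _ _ (Xr _ Uq) (UP _ Uq).
  + move=> q Uq; have [dG _ _ _ _] := rP _ _ (Xr _ Uq) (UP _ Uq).
    have [K' K'0 K'P] := differentiable_lipschitz dG.
    (* [G (X q, q) = 0], so [G (X q, t)] is at most [K' * |t - q|], and [mono] at parameter [t]
       bounds [X t - X q]. *)
    exists (n.+1%:R * K' / a); first by rewrite divr_gt0// mulr_gt0.
    have cXq : (X q, t) @[t --> q] --> (X q, q).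
      exact: (@cvg_pair _ _ _ _ (nbhs (X q)) (nbhs q) _ _ _ _ _ (cvg_cst _) cvg_id).
    apply: (@filterS _ (nbhs q) _ _ _ _ (cXq _ K'P)) => t /=.
    rewrite (XP _ Uq).2 subr0 prod_normE /= subrr normr0 max_r// => Gt Ut.
    rewrite mulrAC ler_pdivlMr// mulrC (le_trans (mono _ _ Ut (Xr _ Uq)))//.
    by rewrite -mulrA ler_pM// ?ler_nat.
  + near=> q; split; last by near: q.
    near: q; apply: (@cvgr_lt _ _ _ _ (fun q => `|q - p0|) `|p - p0|) => //.
    apply: cvg_norm; apply: cvgB; [exact: cvg_id|exact: cvg_cst].
Unshelve. all: by end_near. Qed.

End ParametricMinimizer.

(** * Continuously differentiable functions near a point *)

Section Gradient.
Context {R : realType} {n : nat}.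
Implicit Types (g : 'rV[R]_n -> R) (x : 'rV[R]_n).

Lemma derive_rV_sum (W : normedModType R) (g : 'rV[R]_n -> W) x d :
  differentiable g x ->
  'D_d g x = \sum_(j < n) d 0 j *: 'D_(ebasis R j) g x.
Proof.
move=> dg; rewrite deriveE// [in LHS](row_sum_delta d) linear_sum.
by apply: eq_bigr => j _; rewrite linearZ /= deriveE.
Qed.

Lemma derive_dot_grad g x d : differentiable g x -> 'D_d g x = dot (grad g x) d.
Proof.
move=> dg; rewrite derive_rV_sum//; apply: eq_bigr => j _.
by rewrite mxE mulrC.
Qed.

Lemma differentiable_coord_comp (V : normedModType R) (g : V -> 'rV[R]_n) z j :
  differentiable g z -> differentiable (fun y => g y 0 j) z.
Proof.
move=> dg; apply: (@differentiable_comp _ _ _ _ g (fun v => v 0 j)) => //.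
exact: differentiable_coord.
Qed.

Lemma differentiable_rV (V : normedModType R) (g : V -> 'rV[R]_n) z :
  (forall j, differentiable (fun y => g y 0 j) z) -> differentiable g z.
Proof.
move=> dg; rewrite (_ : g = \sum_(j < n) (fun y => g y 0 j *: ebasis R j)).
  by apply: differentiable_sum => j; apply: differentiableZl.
by apply/funext => y; rewrite fct_sumE [LHS]row_sum_delta.
Qed.

Lemma entry_le_frob k l (A : 'M[R]_(k, l)) i j : `|A i j| <= frob A.
Proof.
rewrite -sqrtr_sqr ler_wsqrtr// (bigD1 i)//= (bigD1 j)//= -addrA lerDl.
by rewrite addr_ge0//; do 2?[apply: sumr_ge0 => ? _]; rewrite sqr_ge0.
Qed.

End Gradient.

Lemma derive_scalar_comp (R : realType) (V : normedModType R) (f : V -> R)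
    (phi : R -> R) (z v : V) (dphi : R) :
  differentiable f z -> is_derive (f z) 1 phi dphi ->
  differentiable (phi \o f) z /\ 'D_v (phi \o f) z = dphi * 'D_v f z.
Proof.
move=> df [dphi1 dphiE]; have dphi2 : differentiable phi (f z).
  exact/derivable1_diffP.
have dc : differentiable (phi \o f) z by exact: differentiable_comp.
split=> //; rewrite deriveE// diff_comp//= deriv1E// derive1E dphiE deriveE//.
by rewrite mulrC.
Qed.

Section C1Calculus.
Context {R : realType} {V : normedModType R}.
Implicit Types f g : V -> R.

Lemma near_eq_continuous (W : normedModType R) (f g : V -> W) z :
  (\forall y \near z, f y = g y) -> {for z, continuous g} -> {for z, continuous f}.
Proof.
move=> fg cg; rewrite /prop_for /continuous_at (nbhs_singleton fg).
by apply: cvg_trans cg; apply: near_eq_cvg; apply: filterS fg => y ->.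
Qed.

(** By [near_join] the formula [Df] is valid on a whole neighborhood of each nearby point, so its
    continuity passes to the actual derivative. *)
Lemma C1near_intro (W : normedModType R) (f : V -> W) (Df : V -> V -> W) z0 :
  (\forall z \near z0, [/\ differentiable f z, forall v, 'D_v f z = Df v z &
     forall v, {for z, continuous (Df v)}]) -> C1near f z0.
Proof.
move=> /near_join; apply: filterS => z nz.
have [dz _ cz] := nbhs_singleton nz; split=> // v.
apply: near_eq_continuous (cz v).
by apply: filterS nz => y [_ + _]; exact.
Qed.

Lemma C1nearD f g z0 : C1near f z0 -> C1near g z0 -> C1near (fun z => f z + g z) z0.
Proof.
move=> cf cg; apply: (C1near_intro (Df := fun v z => 'D_v f z + 'D_v g z)).
apply: filterS2 cf cg => z [df Df] [dg Dg].
split; first exact: differentiableD.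
- by move=> v; apply: deriveD; exact: diff_derivable.
- by move=> v; exact: (continuousD (Df v) (Dg v)).
Qed.

Lemma C1nearM f g z0 : C1near f z0 -> C1near g z0 -> C1near (fun z => f z * g z) z0.
Proof.
move=> cf cg.
apply: (C1near_intro (Df := fun v z => f z * 'D_v g z + g z * 'D_v f z)).
apply: filterS2 cf cg => z [df Df] [dg Dg].
split; first exact: differentiableM.
- by move=> v; apply: deriveM; exact: diff_derivable.
- move=> v; apply: continuousD.
    exact: (continuousM (differentiable_continuous df) (Dg v)).
  exact: (continuousM (differentiable_continuous dg) (Df v)).
Qed.

Lemma C1near_cst (c : R) (z0 : V) : C1near (fun=> c) z0.
Proof.
apply: (C1near_intro (Df := fun v z => 0)); apply: nearW => z.
split; first exact: differentiable_cst.
- by move=> v; exact: derive_cst.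
- by move=> v; exact: cst_continuous.
Qed.

Lemma C1nearZ (c : R) f z0 : C1near f z0 -> C1near (fun z => c * f z) z0.
Proof. by apply: C1nearM; exact: C1near_cst. Qed.

Lemma C1nearB f g z0 : C1near f z0 -> C1near g z0 -> C1near (fun z => f z - g z) z0.
Proof.
move=> cf /(C1nearZ (-1)) cg.
rewrite (_ : (fun z => _) = (fun z => f z + (-1) * g z)); first exact: C1nearD.
by apply/funext => z; rewrite mulN1r.
Qed.

Lemma C1near_sum k (f : 'I_k -> V -> R) z0 : (forall i, C1near (f i) z0) ->
  C1near (fun z => \sum_(i < k) f i z) z0.
Proof.
move=> cf; rewrite (_ : (fun z => _) = \sum_(i < k) f i); last first.
  by apply/funext => z; rewrite fct_sumE.
apply: (big_ind (fun g => C1near g z0)) => [|g1 g2 c1 c2|i _].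
- exact: (C1near_cst 0).
- exact: (C1nearD c1 c2).
- exact: cf.
Qed.

Lemma C1near_linear (W : normedModType R) (L : {linear V -> W}) z0 :
  continuous L -> C1near L z0.
Proof.
move=> cL; apply: (C1near_intro (Df := fun v z => L v)); apply: nearW => z.
split; first exact: linear_differentiable.
- by move=> v; rewrite deriveE ?diff_lin//; exact: linear_differentiable.
- by move=> v; exact: cst_continuous.
Qed.

Lemma C1near_sqrt f z0 : C1near f z0 -> 0 < f z0 ->
  C1near (fun z => Num.sqrt (f z)) z0.
Proof.
move=> cf fz0.
apply: (C1near_intro (Df := fun v z => (2 * Num.sqrt (f z))^-1 * 'D_v f z)).
have cf0 : {for z0, continuous f}.
  by apply: differentiable_continuous; case: (nbhs_singleton cf).
apply: filterS2 cf (cvgr_gt _ cf0 _ fz0) => z [df Df] fz.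
have dc v := derive_scalar_comp v df (is_derive1_sqrt fz).
split; first by have [] := dc 0.
- by move=> v; have [] := dc v.
- move=> v; apply: continuousM; last exact: Df.
  apply: continuousV; first by rewrite gt_eqF// mulr_gt0// sqrtr_gt0.
  apply: continuousM; first exact: cst_continuous.
  apply: (continuous_comp (f := f)); first exact: differentiable_continuous.
  exact: sqrt_continuous.
Qed.

Lemma C1near_rV n (g : V -> 'rV[R]_n) z0 :
  (forall j, C1near (fun z => g z 0 j) z0) -> C1near g z0.
Proof.
move=> cg.
apply: (C1near_intro (Df := fun v z => \row_j 'D_v (fun y => g y 0 j) z)).
have : \forall z \near z0, forall j, differentiable (fun y => g y 0 j) z /\
    forall v, {for z, continuous (fun y => 'D_v (fun y => g y 0 j) y)}.
  by apply: filter_forall => j; exact: cg.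
apply: filterS => z H.
have dg : differentiable g z by apply: differentiable_rV => j; case: (H j).
split=> // [v|v].
  rewrite derive_mx; last exact: diff_derivable.
  by apply/rowP => j; rewrite !mxE.
apply/cvgrPdist_le => e e0.
have : \forall y \near z, forall j,
    `|'D_v (fun y => g y 0 j) z - 'D_v (fun y => g y 0 j) y| <= e.
  apply: filter_forall => j; have [_ /(_ v)/cvgrPdist_le] := H j; exact.
apply: filterS => y ye; apply: norm_rV_le => [|j]; first exact: ltW.
by rewrite !mxE.
Qed.

End C1Calculus.

Lemma C1near_comp_fst (R : realType) (U P W : normedModType R) (g : U -> W) x0 (p0 : P) :
  C1near g x0 -> C1near (fun z : U * P => g z.1) (x0, p0).
Proof.
move=> cg; apply: (C1near_intro (Df := fun v z => 'D_(v.1) g z.1)).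
have cfst : fst @ (x0, p0) --> x0 by exact: cvg_fst.
apply: (@filterS _ (nbhs (x0, p0)) _ _ _ _ (cfst _ cg)) => z [dg Dg].
have dfst : is_diff z (fst : U * P -> U) fst.
  apply: DiffDef; first by apply: linear_differentiable => ?; exact: cvg_fst.
  by apply: diff_lin => ?; exact: cvg_fst.
have dc : differentiable (g \o (fst : U * P -> U)) z by exact: differentiable_comp.
split; first exact: dc.
- move=> v /=; rewrite (deriveE _ dc) (deriveE _ dg) diff_comp//.
  by rewrite diff_val.
- move=> v; have cz : {for z, continuous (fst : U * P -> U)} by exact: cvg_fst.
  exact: (continuous_comp cz (Dg v.1)).
Qed.

(** The Lipschitz bound on the Hessian makes each of its entries continuous near [x0], and the
    derivatives of the gradient are combinations of these entries. *)
Lemma C1near_grad (R : realType) n (g : 'rV[R]_n -> R) x0 j :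
  twice_diff g -> hess_lipschitz_near g x0 -> C1near (fun x => grad g x 0 j) x0.
Proof.
move=> dg [r [L [r0 rP]]].
pose Df (v x : 'rV[R]_n) : R := \sum_(k < n) v 0 k * hess g x j k.
apply: (C1near_intro (Df := Df)).
have nr : \forall x \near x0, enorm (x - x0) < r.
  have r'0 : 0 < r / n.+1%:R by rewrite divr_gt0.
  apply: filterS (nbhsx_ballx x0 _ r'0) => x; rewrite -ball_normE /= distrC.
  by rewrite ltr_pdivlMr// mulrC; exact: le_lt_trans (enorm_le_norm _).
move/near_join: nr; apply: filterS => x nx.
have xr := nbhs_singleton nx.
have dgj : differentiable (fun x => grad g x 0 j) x.
  by apply: differentiable_coord_comp; case: (dg x).
split=> // v.
- by rewrite derive_rV_sum//; apply: eq_bigr => k _; rewrite mxE.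
- apply: (@cvg_sum _ _ _ (nbhs x)) => k _.
  apply: (@cvgM _ _ (nbhs x)); first exact: cvg_cst.
  apply/cvgrPdist_le => e e0.
  (* [L] may be zero or negative, so a positive majorant replaces it before dividing. *)
  pose M := (`|L| + 1) * n.+1%:R.
  have M0 : 0 < M by rewrite mulr_gt0// ltr_wpDl.
  near=> y.
  have yr : enorm (y - x0) < r by near: y.
  have -> : hess g x j k - hess g y j k = (hess g x - hess g y) j k.
    by rewrite [RHS]mxE [X in _ = _ + X]mxE.
  apply: le_trans (entry_le_frob _ _ _) _.
  apply: le_trans (rP _ _ xr yr) _.
  apply: (@le_trans _ _ ((`|L| + 1) * (n.+1%:R * `|x - y|))).
    apply: (@le_trans _ _ (`|L| * enorm (x - y))).
      by rewrite ler_wpM2r ?sqrtr_ge0// ler_norm.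
    by apply: ler_pM; rewrite ?enorm_le_norm ?sqrtr_ge0 ?lerDl.
  rewrite mulrA -/M mulrC -ler_pdivlMr//; near: y.
  have eM : 0 < e / M by rewrite divr_gt0.
  by apply: filterS (nbhsx_ballx x _ eM) => y; rewrite -ball_normE => /ltW.
Unshelve. all: by end_near. Qed.

(** * The penalty function and its gradient *)

Lemma C1near_twice_diff (R : realType) n (g : 'rV[R]_n -> R) x0 :
  twice_diff g -> C1near g x0.
Proof.
move=> dg; pose Df (v x : 'rV[R]_n) : R := \sum_(k < n) grad g x 0 k * v 0 k.
apply: (C1near_intro (Df := Df)); apply: (@filterE _ (nbhs x0)) => x.
have [dgx dgrad] := dg x; split=> // v; first exact: derive_dot_grad.
apply: (@cvg_sum _ _ _ (nbhs x)) => k _.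
apply: (@cvgM _ _ (nbhs x)); last exact: cvg_cst.
apply: (@differentiable_continuous _ _ _ x (fun y => grad g y 0 k)).
exact: differentiable_coord_comp.
Qed.

Section Penalty.
Context {R : realType}.
Implicit Types (w mu rho s : R).

(** The summand [h_i] as a function of [w = s_i - rho c_i(x)] alone, with [s] frozen in the last
    term, so that one scalar derivative and the chain rule suffice. *)
Definition penalty mu rho s w : R :=
  (if mu == 0 then 0 else
     - mu * ln ((Num.sqrt (w ^+ 2 + 4 * rho * mu) - w) / (2 * rho)))
  + rho / 2 * ((Num.sqrt (w ^+ 2 + 4 * rho * mu) + w) / (2 * rho)) ^+ 2
  - s ^+ 2 / (2 * rho).

(** With [S] the square root, [z' = - z / S] and [y' = y / S], so the derivative is
    [(mu + rho y^2) / S]. As [mu = rho y z] and [y + z = S / rho], this equals [y]. Positivity of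
    the radicand also admits [mu = 0] when [w] is nonzero. *)
Lemma is_derive_penalty mu rho s w : 0 < rho -> 0 <= mu ->
  0 < w ^+ 2 + 4 * rho * mu ->
  is_derive w 1 (penalty mu rho s)
    ((Num.sqrt (w ^+ 2 + 4 * rho * mu) + w) / (2 * rho)).
Proof.
move=> rho0 mu0 S0; set k := 4 * rho * mu in S0 *.
pose S (t : R) : R := Num.sqrt (t ^+ 2 + k).
have SS : S w ^+ 2 = w ^+ 2 + k by rewrite sqr_sqrtr// ltW.
have Sw0 : 0 < S w by rewrite sqrtr_gt0.
have dq : is_derive w 1 (fun t : R => t ^+ 2 + k) (2 * w).
  rewrite (_ : (fun t => _) = (id ^+ 2) + cst k)//.
  by apply: is_derive_eq; rewrite /GRing.scale /=; ring.
have dS : is_derive w 1 S (w / S w).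
  have /derivable1_diffP dq' := @ex_derive _ _ _ _ _ _ _ dq.
  have [dc De] := derive_scalar_comp (1 : R) dq' (is_derive1_sqrt S0).
  apply: DeriveDef; first exact/derivable1_diffP.
  by rewrite De derive_val -/(S w); field; rewrite gt_eqF.
pose zz (t : R) := (2 * rho)^-1 * (S t - t).
pose yy (t : R) := (2 * rho)^-1 * (S t + t).
have dz : is_derive w 1 zz ((2 * rho)^-1 * (w / S w - 1)).
  rewrite (_ : zz = (2 * rho)^-1 *: (S - id))//; exact: is_deriveZ.
have dy : is_derive w 1 yy ((2 * rho)^-1 * (w / S w + 1)).
  rewrite (_ : yy = (2 * rho)^-1 *: (S + id))//; exact: is_deriveZ.
have dy2 : is_derive w 1 (fun t => rho / 2 * yy t ^+ 2)
    (rho * yy w * ((2 * rho)^-1 * (w / S w + 1))).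
  rewrite (_ : (fun t => _) = (rho / 2) *: (yy ^+ 2))//.
  by apply: is_derive_eq; rewrite /GRing.scale /= expr1; field; rewrite !gt_eqF.
have dln : is_derive w 1 (fun t => if mu == 0 then 0 else - mu * ln (zz t))
    (mu / S w).
  have [mue|mun0] := eqVneq mu 0.
    by rewrite [X in X / _]mue mul0r; exact: is_derive_cst.
  have mup : 0 < mu by rewrite lt_def mun0.
  have zw : 0 < zz w.
    rewrite mulr_gt0 ?invr_gt0 ?mulr_gt0// subr_gt0 (le_lt_trans (ler_norm w))//.
    by rewrite -sqrtr_sqr ltr_sqrt// ltrDl !mulr_gt0.
  have /derivable1_diffP dz' := @ex_derive _ _ _ _ _ _ _ dz.
  have [dc De] := derive_scalar_comp (1 : R) dz' (is_derive1_ln zw).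
  have dlnz : is_derive w 1 (@ln R \o zz) ((zz w)^-1 * ((2 * rho)^-1 * (w / S w - 1))).
    apply: DeriveDef; first exact/derivable1_diffP.
    by rewrite De derive_val.
  rewrite (_ : (fun t => _) = (- mu) *: (@ln R \o zz))//.
  apply: is_derive_eq; rewrite /GRing.scale /= /zz.
  have SwN : S w - w != 0.
    by apply: contraTneq zw => h; rewrite /zz h mulr0 ltxx.
  by field; rewrite SwN !gt_eqF.
rewrite (_ : penalty mu rho s = (fun t => if mu == 0 then 0 else - mu * ln (zz t))
    + (fun t => rho / 2 * yy t ^+ 2) - cst (s ^+ 2 / (2 * rho))); last first.
  apply/funext => t; rewrite /penalty -/k -/(S t).
  by rewrite ![_ / (2 * rho)]mulrC.
apply: is_derive_eq; rewrite subr0 -/(S w) /yy.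
(* Eliminating [mu] leaves an identity in [S w], [w] and [rho], which [field] settles with [S w] as
   an atom. *)
have kE : mu = (S w ^+ 2 - w ^+ 2) / (4 * rho).
  by rewrite SS /k; field; rewrite gt_eqF.
rewrite {1}kE; field; rewrite !gt_eqF//.
Qed.

End Penalty.

Section Multiplier.
Context {R : realType} {n m : nat}.
Variables (f : 'rV[R]_n -> R) (c : 'I_m -> 'rV[R]_n -> R) (rho : R).
Local Notation Z := ('rV[R]_n * ('rV[R]_m * R))%type.

Definition shifted (i : 'I_m) (z : Z) : R := z.2.1 0 i - rho * c i z.1.

Definition multiplier (i : 'I_m) (z : Z) : R :=
  (Num.sqrt (shifted i z ^+ 2 + 4 * rho * z.2.2) + shifted i z) / 2.

Definition gradF (z : Z) : 'rV[R]_n :=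
  grad f z.1 - \sum_(i < m) multiplier i z *: grad (c i) z.1.

Lemma multiplier_yfun x s mu i : rho != 0 ->
  rho * yfun c x s mu rho i = multiplier i (x, (s, mu)).
Proof. by move=> rho0; rewrite /yfun /multiplier /shifted /=; field. Qed.

Lemma hfunE x s mu i :
  hfun c x s mu rho i = penalty mu rho (s 0 i) (shifted i (x, (s, mu))).
Proof. by []. Qed.

Hypothesis rho_gt0 : 0 < rho.
Hypothesis df : twice_diff f.
Hypothesis dc : forall i, twice_diff (c i).

Lemma C1near_shifted i z0 : C1near (shifted i) z0.
Proof.
case: z0 => x0 p0; apply: C1nearB.
  have @L : {linear Z -> R}.
    by exists (fun z : Z => z.2.1 0 i); do 2![eexists]; do ?[constructor];
      rewrite ?mxE// => ? *; rewrite ?mxE//; move=> ?; rewrite !mxE.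
  apply: (@C1near_linear _ _ _ L) => z.
  apply: (@continuous_comp _ _ _ (fun z : Z => z.2.1) (fun v => v 0 i)).
    apply: (@continuous_comp _ _ _ (fun z : Z => z.2) fst).
      exact: cvg_snd.
    exact: cvg_fst.
  exact: coord_continuous.
apply: C1nearZ; apply: (@C1near_comp_fst _ _ _ _ (c i)).
exact: C1near_twice_diff.
Qed.

Lemma differentiable_shifted i z : differentiable (shifted i) z.
Proof. by have [] := nbhs_singleton (C1near_shifted i z). Qed.

Lemma is_derive_shifted i p x (d : 'rV[R]_n) :
  is_derive x d (fun y => shifted i (y, p)) (- (rho * dot (grad (c i) x) d)).
Proof.
have [dcx _] := dc i x.
have Dc : is_derive x d (c i) (dot (grad (c i) x) d).
  by apply: DeriveDef; [exact: diff_derivable|exact: derive_dot_grad].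
have -> : (fun y => shifted i (y, p)) = cst (p.1 0 i) - rho *: c i by [].
by apply: is_derive_eq; rewrite sub0r.
Qed.

Lemma C1near_multiplier i z0 : 0 < shifted i z0 ^+ 2 + 4 * rho * z0.2.2 ->
  C1near (multiplier i) z0.
Proof.
move=> pos; rewrite (_ : multiplier i = fun z => 2^-1 *
    (Num.sqrt (shifted i z * shifted i z + 4 * rho * z.2.2) + shifted i z)).
  apply: C1nearZ; apply: C1nearD; last exact: C1near_shifted.
  apply: C1near_sqrt; last by rewrite -expr2.
  apply: C1nearD; first by apply: C1nearM; exact: C1near_shifted.
  apply: C1nearZ.
  have @L : {linear Z -> R}.
    by exists (fun z : Z => z.2.2); do 2![eexists]; do ?[constructor].
  apply: (@C1near_linear _ _ _ L) => z.
  by apply: (@continuous_comp _ _ _ (fun z : Z => z.2) snd); exact: cvg_snd.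
by apply/funext => z; rewrite /multiplier mulrC expr2.
Qed.

Lemma C1near_gradF (x0 : 'rV[R]_n) (p0 : 'rV[R]_m * R) :
  hess_lipschitz_near f x0 -> (forall i, hess_lipschitz_near (c i) x0) ->
  (forall i, 0 < shifted i (x0, p0) ^+ 2 + 4 * rho * p0.2) ->
  C1near gradF (x0, p0).
Proof.
move=> lf lc pos; apply: C1near_rV => j.
rewrite (_ : (fun z => _) = fun z : Z => grad f z.1 0 j -
    \sum_(i < m) multiplier i z * grad (c i) z.1 0 j).
  apply: C1nearB.
    apply: (@C1near_comp_fst _ _ _ _ (fun x => grad f x 0 j)).
    exact: (C1near_grad j df lf).
  apply: C1near_sum => i; apply: C1nearM; first exact: C1near_multiplier.
  apply: (@C1near_comp_fst _ _ _ _ (fun x => grad (c i) x 0 j)).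
  exact: (C1near_grad j (dc i) (lc i)).
apply/funext => z; rewrite /gradF mxE [X in _ + X]mxE summxE.
by congr (_ - _); apply: eq_bigr => i _; rewrite [LHS]mxE.
Qed.

(** The chain rule through [shifted] multiplies [y_i] by [- rho] times the gradient of [c_i], and
    [rho * y_i] is the multiplier. *)
Lemma derive_Ffun x (p : 'rV[R]_m * R) : 0 <= p.2 ->
  (forall i, 0 < shifted i (x, p) ^+ 2 + 4 * rho * p.2) ->
  differentiable (fun y => Ffun f c y p.1 p.2 rho) x /\
  forall d, 'D_d (fun y => Ffun f c y p.1 p.2 rho) x = dot (gradF (x, p)) d.
Proof.
move=> mu0 pos.
have dsh i : differentiable (fun y => shifted i (y, p)) x.
  exact/differentiable_slice/differentiable_shifted.
pose h i := fun y => hfun c y p.1 p.2 rho i.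
have dh i d := derive_scalar_comp d (dsh i)
  (is_derive_penalty (p.1 0 i) rho_gt0 mu0 (pos i)).
have FE : (fun y => Ffun f c y p.1 p.2 rho) = f + \sum_(i < m) h i.
  apply/funext => y; rewrite /Ffun; congr (_ + _).
  by rewrite fct_sumE.
have hE i : h i = penalty p.2 rho (p.1 0 i) \o (fun y => shifted i (y, p)).
  by apply/funext => y; rewrite /h hfunE; case: (p).
have dhi i : differentiable (h i) x by rewrite hE; have [] := dh i 0.
have [dfx _] := df x.
split; first by rewrite FE; apply: differentiableD => //; exact: differentiable_sum.
move=> d; rewrite FE deriveD; last 2 first.
- exact: diff_derivable.
- by apply: derivable_sum => i; exact: diff_derivable.
rewrite derive_sum; last by move=> i; exact: diff_derivable.
rewrite derive_dot_grad// /gradF dotBl dot_suml -sumrN; congr (_ + _).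
apply: eq_bigr => i _; rewrite hE; have [_ ->] := dh i d.
have [_ ->] := is_derive_shifted i p x d.
rewrite dotZl /multiplier /=; field.
by rewrite gt_eqF.
Qed.

End Multiplier.

(** * The gradient map and its linearization at the KKT point *)

Section QuadraticForms.
Context {R : realType} {n : nat}.

Lemma quad_dot (B : 'M[R]_n) (d : 'rV[R]_n) :
  (d *m B *m d^T) 0 0 = dot (d *m B) d.
Proof. by rewrite mxE; apply: eq_bigr => j _; rewrite [d^T _ _]mxE. Qed.

Lemma dot_mulmx_outer (g d : 'rV[R]_n) : dot (d *m (g^T *m g)) d = dot g d ^+ 2.
Proof.
rewrite mulmxA [d *m g^T]mx11_scalar mul_scalar_mx dotZl expr2; congr (_ * _).
by rewrite mxE; apply: eq_bigr => j _; rewrite [g^T _ _]mxE mulrC.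
Qed.

(** Row [i] of the Hessian differentiates component [i] of the gradient, while [d *m hess g x] sums
    over rows; as quadratic forms both agree after exchanging the sums. *)
Lemma dot_derive_grad (g : 'rV[R]_n -> R) (x d : 'rV[R]_n) : twice_diff g ->
  dot ('D_d (grad g) x) d = dot (d *m hess g x) d.
Proof.
move=> dg; have [_ dgrad] := dg x.
transitivity (\sum_(i < n) \sum_(j < n) d 0 i * hess g x i j * d 0 j).
  apply: eq_bigr => i _.
  rewrite derive_mx ?mxE; last exact: diff_derivable.
  rewrite derive_rV_sum; last exact: differentiable_coord_comp.
  rewrite mulr_suml; apply: eq_bigr => j _.
  by rewrite [hess g x i j]mxE /GRing.scale /=; ring.
rewrite exchange_big; apply: eq_bigr => j _.
by rewrite mxE mulr_suml.
Qed.

End QuadraticForms.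

Section Kkt.
Context {R : realType} {n m : nat}.
Variables (f : 'rV[R]_n -> R) (c : 'I_m -> 'rV[R]_n -> R) (rho : R).
Variables (x0 : 'rV[R]_n) (s0 : 'rV[R]_m).
Hypothesis rho_gt0 : 0 < rho.
Hypothesis df : twice_diff f.
Hypothesis dc : forall i, twice_diff (c i).
Hypothesis c_ge0 : forall i, 0 <= c i x0.
Hypothesis s_ge0 : forall i, 0 <= s0 0 i.
Hypothesis compl : \sum_(i < m) s0 0 i * c i x0 = 0.
Hypothesis strict : forall i, 0 < s0 0 i + c i x0.
Local Notation z0 := (x0, (s0, 0 : R)).

(** A vanishing sum of nonnegative products makes each product vanish; strict complementarity then
    decides which factor is zero. *)
Lemma shifted_kkt i :
  shifted c rho i z0 = if 0 < s0 0 i then s0 0 i else - (rho * c i x0).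
Proof.
have /psumr_eq0P/(_ compl) : forall j, true -> 0 <= s0 0 j * c j x0.
  by move=> j _; rewrite mulr_ge0.
move=> /(_ i isT)/eqP; rewrite mulf_eq0 /shifted /= => /orP[/eqP si|/eqP ci].
  by rewrite si ltxx sub0r.
by have := strict i; rewrite ci addr0 => ->; rewrite mulr0 subr0.
Qed.

Lemma shifted_kkt_sign i :
  if 0 < s0 0 i then 0 < shifted c rho i z0 else shifted c rho i z0 < 0.
Proof.
rewrite shifted_kkt; case: (boolP (0 < s0 0 i)) => // si; have := strict i.
have -> : s0 0 i = 0 by apply/eqP; rewrite eq_le s_ge0 leNgt si.
by rewrite add0r => ci; rewrite oppr_lt0 mulr_gt0.
Qed.

Lemma shifted_kkt_neq0 i : shifted c rho i z0 != 0.
Proof.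
by have := shifted_kkt_sign i; case: ifP => _ h; rewrite ?(gt_eqF h) ?(lt_eqF h).
Qed.

Lemma multiplier_mu0 i x (s : 'rV[R]_m) : multiplier c rho i (x, (s, 0)) =
  Num.max 0 (shifted c rho i (x, (s, 0))).
Proof.
rewrite /multiplier /= mulr0 addr0 sqrtr_sqr; set w := shifted _ _ _ _.
by have [w0|w0] := leP 0 w; [rewrite ger0_norm//|rewrite ltr0_norm//]; field.
Qed.

Lemma multiplier_kkt i : multiplier c rho i z0 = s0 0 i.
Proof.
rewrite multiplier_mu0; have := shifted_kkt_sign i.
case: ifPn => [si|si] h.
  by rewrite max_r ?ltW// shifted_kkt si.
by rewrite max_l ?ltW//; apply/eqP; rewrite eq_le s_ge0 leNgt si.
Qed.

(** At [mu = 0] the multiplier is the positive part of [shifted], whose argument is nonzero at the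
    KKT point. Locally it is therefore [shifted] itself or zero, which selects the active
    constraints in the second-order matrix. *)
Lemma is_derive_multiplier_kkt i (d : 'rV[R]_n) :
  is_derive x0 d (fun y => multiplier c rho i (y, (s0, 0)))
    (if 0 < s0 0 i then - (rho * dot (grad (c i) x0) d) else 0).
Proof.
have cs : {for x0, continuous (fun y => shifted c rho i (y, (s0, 0)))}.
  apply: differentiable_continuous; apply: differentiable_slice.
  exact: (differentiable_shifted rho dc).
have := shifted_kkt_sign i; case: ifP => _ h.
  apply: near_eq_is_derive (is_derive_shifted rho dc i (s0, 0) x0 d).
  by apply: filterS (cvgr_gt _ cs _ h) => y hy; rewrite multiplier_mu0 max_r ?ltW.
apply: near_eq_is_derive (is_derive_cst 0 x0 d).
by apply: filterS (cvgr_lt _ cs _ h) => y hy; rewrite multiplier_mu0 max_l ?ltW.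
Qed.

Lemma gradF_kkt : grad f x0 = \sum_(i < m) s0 0 i *: grad (c i) x0 ->
  gradF f c rho z0 = 0.
Proof.
move=> kkt; rewrite /gradF kkt; apply/eqP; rewrite subr_eq0; apply/eqP.
by apply: eq_bigr => i _; rewrite multiplier_kkt.
Qed.

(** The component of [gradF] along [d] is differentiated by the product rule. Multiplier values
    produce the Hessian of the Lagrangian; multiplier derivatives produce the squares
    [rho * dot (grad (c i) x0) d ^+ 2] over the active indices. *)
Lemma dot_derive_gradF_kkt (d : 'rV[R]_n) :
  differentiable (gradF f c rho) z0 ->
  dot ('D_(d, 0) (gradF f c rho) z0) d =
  (d *m (hess f x0 - \sum_(i < m) s0 0 i *: hess (c i) x0
    + rho *: \sum_(i < m | 0 < s0 0 i) ((grad (c i) x0)^T *m grad (c i) x0))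
   *m d^T) 0 0.
Proof.
move=> dG; rewrite -derive_fst_slice quad_dot.
have dgrad (g : 'rV[R]_n -> R) : twice_diff g ->
    is_derive x0 d (fun y => dot (grad g y) d) (dot (d *m hess g x0) d).
  move=> dg; rewrite -dot_derive_grad//; apply: is_derive_dotl.
  by apply/derivableP/diff_derivable; case: (dg x0).
have D1 : is_derive x0 d (fun y => dot (gradF f c rho (y, (s0, 0))) d)
    (dot ('D_d (fun y => gradF f c rho (y, (s0, 0))) x0) d).
  apply: is_derive_dotl; apply/derivableP/diff_derivable.
  exact: differentiable_slice.
rewrite -(@derive_val _ _ _ _ _ _ _ D1).
rewrite (_ : (fun y => _) = (fun y => dot (grad f y) d) - \sum_(i < m)
   ((fun y => multiplier c rho i (y, (s0, 0))) * (fun y => dot (grad (c i) y) d)));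
   last first.
  apply/funext => y; rewrite /gradF dotBl dot_suml /=; congr (_ - _).
  by rewrite fct_sumE; apply: eq_bigr => i _; rewrite dotZl.
have D2 i : is_derive x0 d
   ((fun y => multiplier c rho i (y, (s0, 0))) * (fun y => dot (grad (c i) y) d))
   (s0 0 i * dot (d *m hess (c i) x0) d +
    dot (grad (c i) x0) d * (if 0 < s0 0 i then - (rho * dot (grad (c i) x0) d) else 0)).
  have := is_derive_multiplier_kkt i d; have := dgrad _ (dc i) => Da Db.
  by apply: is_derive_eq; rewrite /GRing.scale /= multiplier_kkt.
have D3 := dgrad _ df.
have D4 := is_derive_sum D2.
rewrite (@derive_val _ _ _ _ _ _ _ (is_deriveB D3 D4)).
rewrite mulmxDr mulmxBr dotDl dotBl -addrA; congr (_ + _).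
rewrite big_split /= opprD; congr (_ + _).
  congr (- _); rewrite mulmx_sumr dot_suml; apply: eq_bigr => i _.
  by rewrite -scalemxAr dotZl.
rewrite -scalemxAr dotZl mulmx_sumr dot_suml mulr_sumr -sumrN [RHS]big_mkcond.
apply: eq_bigr => i _; case: ifP => _; last by rewrite mulr0 oppr0.
by rewrite dot_mulmx_outer; ring.
Qed.

Lemma near_shifted_neq0 :
  \forall z \near z0, forall i, 0 < shifted c rho i z ^+ 2.
Proof.
apply: (@filter_forall _ _ _ (nbhs z0)) => i.
have cs : {for z0, continuous (shifted c rho i)}.
  exact/differentiable_continuous/(differentiable_shifted rho dc).
have cn : `|shifted c rho i z| @[z --> z0] --> `|shifted c rho i z0|.
  exact: cvg_norm.
have h : 0 < `|shifted c rho i z0| by rewrite normr_gt0 shifted_kkt_neq0.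
apply: filterS (cvgr_gt _ cn _ h) => z hz.
by rewrite exprn_even_gt0//= -normr_gt0.
Qed.

(** The radicands are positive at the KKT point, so the multipliers are differentiable there, with
    value [s0]. *)
Lemma multiplier_lipschitz : exists2 K, 0 < K & \forall z \near z0,
  `|(\row_i multiplier c rho i z) - s0| <= K * `|z - z0|.
Proof.
have dM : differentiable (fun z => \row_i multiplier c rho i z : 'rV[R]_m) z0.
  apply: differentiable_rV => i.
  rewrite (_ : (fun z => _) = multiplier c rho i); last first.
    by apply/funext => z; rewrite mxE.
  have C1 : C1near (multiplier c rho i) z0.
    apply: C1near_multiplier => //.
    by rewrite /= mulr0 addr0; exact: (nbhs_singleton near_shifted_neq0).
  by case: (nbhs_singleton C1).
have := differentiable_lipschitz dM.
rewrite (_ : \row_i multiplier c rho i z0 = s0)//.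
by apply/rowP => i; rewrite mxE multiplier_kkt.
Qed.

End Kkt.

(* Local minimizers and multiplier estimates near a KKT pair *)
Local Close Scope classical_set_scope.

Theorem theorem5p2 (R : realType) (n m : nat)
  (f : 'rV[R]_n -> R) (c : 'I_m -> 'rV[R]_n -> R)
  (xstar : 'rV[R]_n) (sstar : 'rV[R]_m) (rho0 : R) :
  (* KKT pair *)
  grad f xstar = \sum_(i < m) sstar 0 i *: grad (c i) xstar ->
  (forall i, 0 <= c i xstar) ->
  (forall i, 0 <= sstar 0 i) ->
  \sum_(i < m) sstar 0 i * c i xstar = 0 ->
  (* smoothness *)
  twice_diff f -> (forall i, twice_diff (c i)) ->
  hess_lipschitz_near f xstar -> (forall i, hess_lipschitz_near (c i) xstar) ->
  (* LICQ *)
  lin_indep_family (fun i => c i xstar == 0) (fun i => grad (c i) xstar) ->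
  (* strict complementarity *)
  (forall i, 0 < sstar 0 i + c i xstar) ->
  (* second-order condition *)
  0 < rho0 ->
  posdef (hess f xstar - \sum_(i < m) sstar 0 i *: hess (c i) xstar
          + rho0 *: \sum_(i < m | 0 < sstar 0 i) ((grad (c i) xstar)^T *m grad (c i) xstar)) ->
  exists mubar eps delta : R, [/\ 0 < mubar, 0 < eps, 0 < delta &
  exists X : 'rV[R]_m -> R -> 'rV[R]_n,
    [/\ (* X s mu is the unique minimizer of F(., s; mu, rho0) on the open ball *)
        (forall s mu, enorm (s - sstar) <= delta -> 0 <= mu < mubar ->
          [/\ enorm (X s mu - xstar) < eps,
              (forall x, enorm (x - xstar) < eps ->
                 Ffun f c (X s mu) s mu rho0 <= Ffun f c x s mu rho0) &
              (forall x', enorm (x' - xstar) < eps ->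
                 (forall x, enorm (x - xstar) < eps ->
                    Ffun f c x' s mu rho0 <= Ffun f c x s mu rho0) ->
                 x' = X s mu)]),
        (* continuously differentiable on the interior of D *)
        (forall p : 'rV[R]_m * R, enorm (p.1 - sstar) < delta -> 0 < p.2 < mubar ->
           differentiable (fun q : 'rV[R]_m * R => X q.1 q.2) p /\
           forall v : 'rV[R]_m * R,
             {for p, continuous (fun q : 'rV[R]_m * R =>
                                   'D_v (fun r : 'rV[R]_m * R => X r.1 r.2) q)}) &
        (* error bounds *)
        exists C : R, 0 < C /\
          forall s mu, enorm (s - sstar) <= delta -> 0 <= mu < mubar ->
            enorm (X s mu - xstar) <= C * (enorm (s - sstar) + mu) /\
            enorm (rho0 *: yvec c (X s mu) s mu rho0 - sstar)
              <= C * (enorm (s - sstar) + mu)]].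
Proof.
move=> kkt c_ge0 s_ge0 compl df dc lf lc _ strict rho0_gt0 pd.
(* The gradient formula needs [mu >= 0], so [(sstar, 0)] lies on the boundary of the admissible
   parameters, and points with [mu > 0] are interior. *)
pose A : set ('rV[R]_m * R) := [set p | 0 <= p.2]%classic.
pose F x (p : 'rV[R]_m * R) := Ffun f c x p.1 p.2 rho0.
have nonzero := near_shifted_neq0 rho0_gt0 dc c_ge0 s_ge0 compl strict.
have C1 : C1near (gradF f c rho0) (xstar, (sstar, 0)).
  apply: C1near_gradF => // i.
  by rewrite mulr0 addr0; exact: (nbhs_singleton nonzero).
have pos d : d != 0 -> 0 < dot ('D_(d, 0) (gradF f c rho0) (xstar, (sstar, 0))) d.
  move=> d0; rewrite dot_derive_gradF_kkt; [exact: pd|..] => //.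
  by case: (nbhs_singleton C1).
have HF : \forall z \near (xstar, (sstar, 0 : R)), A z.2 ->
    differentiable (F^~ z.2) z.1 /\
    forall d, 'D_d (F^~ z.2) z.1 = dot (gradF f c rho0 z) d.
  apply: filterS nonzero => -[x p] /= wz Ap.
  apply: derive_Ffun => // i.
  by rewrite ltr_pwDl// mulr_ge0// mulr_ge0// ltW.
have [r [dl [C [X [r_gt0 dl_gt0 C_gt0 XP dX]]]]] :=
  parametric_minimizer (gradF_kkt rho0_gt0 c_ge0 s_ge0 compl strict kkt) C1 pos HF.
have [K K_gt0 KP] := multiplier_lipschitz rho0_gt0 dc c_ge0 s_ge0 compl strict.
have [e /= e_gt0 eP] := (nbhs_normP (xstar, (sstar, 0 : R)) _).1 KP.
(* [e] and [e / C] keep [(X (s, mu), (s, mu))] within [e] of the KKT point, where the multiplier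
   bound holds, because [X] moves by at most [C] times the parameter. *)
pose dl' := Num.min dl (Num.min e (e / C)).
have dl'_gt0 : 0 < dl' by rewrite !lt_min dl_gt0 e_gt0 divr_gt0.
have pE (s : 'rV[R]_m) (mu : R) : (s, mu) - (sstar, 0) = (s - sstar, mu).
  by apply: injective_projections => //=; rewrite subr0.
have p_lt (s : 'rV[R]_m) (mu : R) : enorm (s - sstar) < dl' -> 0 <= mu < dl' ->
    `|(s, mu) - (sstar, 0)| < dl'.
  move=> sd /andP[mu0 mud]; rewrite pE prod_normE /= gt_max ger0_norm// mud.
  by rewrite (le_lt_trans (norm_le_enorm _)).
have p_le (s : 'rV[R]_m) (mu : R) : 0 <= mu ->
    `|(s, mu) - (sstar, 0)| <= enorm (s - sstar) + mu.
  move=> mu0; rewrite pE prod_normE /= ge_max ger0_norm// lerDr sqrtr_ge0 andbT.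
  by rewrite (le_trans (norm_le_enorm _))// lerDl.
have dl'_le t : t < dl' -> [/\ t < dl, t < e & t < e / C].
  by rewrite !lt_min => /and3P[].
have half : dl' / 2 < dl' by rewrite ltr_pdivrMr// ltr_pMr// ltr1n.
(* The condition on [s] in [D] is not strict; halving the radius recovers the strict bound [dl']. *)
exists dl', r, (dl' / 2); split=> //; first by rewrite divr_gt0.
exists (fun s mu => X (s, mu)); split.
- move=> s mu sd mud; have [mu0 _] := andP mud.
  have [pdl _ _] := dl'_le _ (p_lt _ _ (le_lt_trans sd half) mud).
  have [Xr _ Xmin] := XP _ pdl mu0.
  have Xr' : enorm (X (s, mu) - xstar) < r.
    rewrite (le_lt_trans (enorm_le_norm _))//.
    (* The margin [n.+2] absorbs the factor [n.+1] lost in passing from the sup norm to the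
       Euclidean norm. *)
    rewrite (@lt_trans _ _ (n.+1%:R * (r / n.+2%:R)))// ?ltr_pM2l//.
    by rewrite mulrA ltr_pdivrMr// mulrC ltr_pM2l// ltr_nat.
  split=> //.
  + move=> x xr; have [->//|xX] := eqVneq x (X (s, mu)).
    by apply/ltW/Xmin => //; exact: le_lt_trans (norm_le_enorm _) xr.
  + move=> x' x'r x'min; apply/eqP; apply: contraT => x'X.
    have := Xmin _ (le_lt_trans (norm_le_enorm _) x'r) x'X.
    by rewrite /F /= ltNge x'min.
- move=> [s mu] /= sd /andP[mu0 mud].
  have -> : (fun q : 'rV[R]_m * R => X (q.1, q.2)) = X.
    by apply/funext => -[].
  have [|pdl _ _] := dl'_le `|(s, mu) - (sstar, 0)|.
    by apply: p_lt; rewrite ?(ltW mu0)//; exact: lt_trans half.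
  apply: dX => //.
  have cmu : (snd @ (s, mu) --> mu)%classic by exact: cvg_snd.
  exact: (cvgr_ge _ cmu _ mu0).
- exists (n.+1%:R * C + m.+1%:R * (K * (C + 1))); split.
    by rewrite addr_gt0// !mulr_gt0// addr_gt0.
  move=> s mu sd mud; have [mu0 _] := andP mud.
  have [pdl pe peC] := dl'_le _ (p_lt _ _ (le_lt_trans sd half) mud).
  have [_ XC _] := XP _ pdl mu0.
  have t0 : 0 <= enorm (s - sstar) + mu by rewrite addr_ge0// sqrtr_ge0.
  rewrite mulrDl; split.
    rewrite (@le_trans _ _ (n.+1%:R * C * (enorm (s - sstar) + mu)))//; last first.
      by rewrite lerDl !mulr_ge0// ?(ltW K_gt0)// addr_ge0// ltW.
    rewrite (le_trans (enorm_le_norm _))// -mulrA ler_wpM2l//.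
    by rewrite (le_trans XC)// ler_wpM2l ?(ltW C_gt0)// p_le.
  rewrite (@le_trans _ _ (m.+1%:R * (K * (C + 1)) * (enorm (s - sstar) + mu)))//;
    last first.
    by rewrite lerDr !mulr_ge0// ltW.
  rewrite (le_trans (enorm_le_norm _))// -mulrA ler_wpM2l//.
  have -> : rho0 *: yvec c (X (s, mu)) s mu rho0 =
      \row_i multiplier c rho0 i (X (s, mu), (s, mu)).
    by apply/rowP => i; rewrite !mxE multiplier_yfun// gt_eqF.
  have zle : `|(X (s, mu), (s, mu)) - (xstar, (sstar, 0))|
      <= (C + 1) * `|(s, mu) - (sstar, 0)|.
    rewrite prod_normE /= ge_max; apply/andP; split.
      by rewrite (le_trans XC)// ler_wpM2r// lerDl.
    by rewrite ler_peMl// lerDr ltW.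
  apply: le_trans (eP (X (s, mu), (s, mu)) _) _.
    rewrite /ball_ /= distrC prod_normE /= gt_max pe andbT.
    by rewrite (le_lt_trans XC)// mulrC -ltr_pdivlMr.
  rewrite -mulrA ler_wpM2l ?(ltW K_gt0)// (le_trans zle)//.
  by rewrite ler_wpM2l ?p_le// addr_ge0// ltW.
Qed.
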